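(* Let $\mathbb{K}$ be a field, let $U$ and $V$ be finite-dimensional vector spaces over $\mathbb{K}$, and let $\mathcal{S}$ be an affine subspace of $\mathcal{L}(U,V)$ such that $\operatorname{codim} \mathcal{S} \leq \dim V-2$ if $\#\mathbb{K}>2$, and $\operatorname{codim} \mathcal{S} \leq \dim V-3$ if $\# \mathbb{K}=2$. Then, every quasi-range-compatible affine map $F : \mathcal{S} \rightarrow V$ is local.
   Context: $\mathcal{L}(U,V)$ is the vector space of all linear maps from $U$ to $V$. Affine subspaces are non-empty; the codimension of an affine subspace $\mathcal{S}$ of $\mathcal{L}(U,V)$ is $\dim \mathcal{L}(U,V)-\dim \mathcal{S}$. For a subset $\mathcal{S}$ of $\mathcal{L}(U,V)$ and a $1$-dimensional linear subspace $D$ of $V$, a map $F : \mathcal{S} \rightarrow V$ is quasi-range-compatible with respect to $D$ when, for all $s \in \mathcal{S}$, $D \not\subset \operatorname{Im} s$ implies $F(s) \in \operatorname{Im} s$. It is quasi-range-compatible when it is quasi-range-compatible with respect to some $1$-dimensional linear subspace of $V$. It is local when there exists $x \in U$ such that $F(s)=s(x)$ for all $s \in \mathcal{S}$. *)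

(* Defs.v *)
From HB Require Import structures.
From mathcomp Require Import all_boot all_order all_algebra.

Set Implicit Arguments.
Unset Strict Implicit.
Unset Printing Implicit Defensive.

Import GRing.Theory.

Local Open Scope ring_scope.

(* Cardinality conditions on a type that need not be finite. *)
Definition card_eq (T : Type) (n : nat) : Prop :=
  exists f : 'I_n -> T, bijective f.

Definition card_gt (T : Type) (n : nat) : Prop :=
  exists f : 'I_n.+1 -> T, injective f.

(* The affine subspace aff_pt + aff_dir, always non-empty. Its set of points   *)
(* determines the direction but not the base point, so equality of affine     *)
(* subspaces is =i rather than Leibniz equality of records.                   *)
Record affspace (K : fieldType) (E : vectType K) : Type :=
  AffSpace { aff_pt : E; aff_dir : {vspace E} }.

Definition in_affspace (K : fieldType) (E : vectType K) (S : affspace E) :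
  pred E := fun x => x - aff_pt S \in aff_dir S.

Canonical affspace_predType (K : fieldType) (E : vectType K) :=
  PredType (@in_affspace K E).

(* The subtraction on nat never truncates, since aff_dir S <= {:E}. *)
Definition aff_codim (K : fieldType) (E : vectType K) (S : affspace E) : nat :=
  (\dim {:E} - \dim (aff_dir S))%N.

(* A map with domain a subset S is represented by a total function, of which  *)
(* only the values on S matter.                                               *)
Definition affine_on (K : fieldType) (E V : vectType K) (S : affspace E)
    (F : E -> V) : Prop :=
  exists f : 'Hom(subvs_of (aff_dir S), V),
    forall (s : E) (w : subvs_of (aff_dir S)),
      s \in S -> F (s + vsval w) = F s + f w.

Definition quasi_range_compatible_wrt (K : fieldType) (U V : vectType K)
    (S : {pred 'Hom(U, V)}) (D : {vspace V}) (F : 'Hom(U, V) -> V) : Prop :=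
  forall s : 'Hom(U, V), s \in S -> ~~ (D <= limg s)%VS -> F s \in limg s.

Definition quasi_range_compatible (K : fieldType) (U V : vectType K)
    (S : {pred 'Hom(U, V)}) (F : 'Hom(U, V) -> V) : Prop :=
  exists D : {vspace V}, \dim D = 1%N /\ quasi_range_compatible_wrt S D F.

Definition local_on (K : fieldType) (U V : vectType K)
    (S : {pred 'Hom(U, V)}) (F : 'Hom(U, V) -> V) : Prop :=
  exists x : U, forall s : 'Hom(U, V), s \in S -> F s = s x.

(* Main.v *)
Require Import Defs.
From HB Require Import structures.
From mathcomp Require Import all_boot all_order all_algebra.
From mathcomp Require Import zify.
From Stdlib Require Import Classical.

Set Implicit Arguments.
Unset Strict Implicit.
Unset Printing Implicit Defensive.

Import GRing.Theory.

Local Open Scope ring_scope.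

(* Write R for the direction of S and L(Y) for the space of maps U -> V with  *)
(* range in Y. For a subspace Y not containing D = <[d]>, one shows that F is *)
(* local modulo Y as soon as codim (R + L(Y)) <= dim V - dim Y - 2 (or - 3    *)
(* over F_2), by induction on codim (R + L(Y)); the theorem is the case Y = 0.*)
(* If R + L(Y) is everything, F induces modulo Y a linear map g on L(U, V)    *)
(* with g(L(Z)) in Z for all Z containing Y but not d; on the maps            *)
(* e_i^* (x) y it yields an endomorphism of V preserving, modulo Y, every     *)
(* line except that of d, hence a homothety modulo Y.                         *)
(* Otherwise, one finds y1 and y2, independent modulo Y, such that            *)
(* Yi = Y + <[yi]> avoids d and R + L(Yi) is larger than R + L(Y). The        *)
(* induction hypothesis gives x1 and x2 with F s = s xi modulo Yi. If         *)
(* x1 != x2, all of R maps x1 - x2 into Y1 + Y2, so that                      *)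
(* codim (R + L(Y1)) >= dim V - dim Y - 2 >= codim (R + L(Y)), which is       *)
(* absurd. Hence x1 = x2 and F s - s x1 lies in the intersection Y of Y1, Y2. *)

(** Enlarging Y line by line uses up the codimension of R + L(Y). Once it is zero
    ([local_modulo_full]), the question reduces to the rigidity of endomorphisms preserving all
    lines but one ([quasi_homothety]). Over F_2 this rigidity fails in a plane (take diag(1, 0),
    with d the sum of the basis vectors), whence the extra dimension there. On the way back,
    [local_modulo] compares the vectors obtained from two independent directions ([pick_two]), and
    [dim_eval_into] forces them to coincide. *)

Section Lines.

Variables (K : fieldType) (V : vectType K).
Implicit Types (Y W N : {vspace V}) (v x y z d : V).

Lemma addv_lineP Y v y :
  reflect (exists a, v - a *: y \in Y) (v \in (Y + <[y]>)%VS).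
Proof.
apply: (iffP memv_addP) => [[w wY [_ /vlineP[a ->] ->]]|[a aY]].
  by exists a; rewrite addrK.
by exists (v - a *: y) => //; exists (a *: y); rewrite ?memvZ ?memv_line ?subrK.
Qed.

Lemma memv_addl Y W v : v \in Y -> v \in (Y + W)%VS.
Proof. by move=> vY; apply: (subvP (addvSl Y W)). Qed.

Lemma memv_addr Y W v : v \in W -> v \in (Y + W)%VS.
Proof. by move=> vW; apply: (subvP (addvSr Y W)). Qed.

Lemma memv_line_addr Y v : v \in (Y + <[v]>)%VS.
Proof. exact/memv_addr/memv_line. Qed.

Lemma cap_addv_lines Y x y v : y \notin (Y + <[x]>)%VS ->
  v \in (Y + <[x]>)%VS -> v \in (Y + <[y]>)%VS -> v \in Y.
Proof.
move=> yNx vx /addv_lineP[b vbY]; case: (eqVneq b 0) vbY => [->|b0] vbY.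
  by rewrite scale0r subr0 in vbY.
case/negP: yNx; rewrite -[y](scalerK b0) memvZ //.
by rewrite -[_ *: y](subKr v) memvB // memv_addl.
Qed.

Lemma notin_subv_ex W : (\dim W < \dim {:V})%N -> exists v, v \notin W.
Proof.
move=> ltW; have /subvPn[v _ vW] : ~~ ({:V} <= W)%VS; last by exists v.
by apply/negP => /dimvS; rewrite leqNgt ltW.
Qed.

Lemma dim_addv_line Y y : (\dim (Y + <[y]>) <= (\dim Y).+1)%N.
Proof.
apply: leq_trans (dimv_add_leqif _ _) _.
by rewrite -addn1 leq_add2l dim_vline leq_b1.
Qed.

Lemma addv_notin W x y : x \in W -> y \notin W -> x + y \notin W.
Proof. by move=> xW; apply: contraNN => xyW; rewrite -(addKr x y) addrC memvB. Qed.

(* h induces on V / Y a map preserving every line except possibly that of d. *)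
Lemma quasi_homothety (h : 'End(V)) Y d :
    (\dim Y + 2 <= \dim {:V})%N ->
    (exists a : K, a != 0 /\ a != 1) \/ (\dim Y + 3 <= \dim {:V})%N ->
    (forall y, y \in Y -> h y \in Y) ->
    (forall y, y \notin (Y + <[d]>)%VS -> h y \in (Y + <[y]>)%VS) ->
  exists c, forall y, h y - c *: y \in Y.
Proof.
set W := (Y + <[d]>)%VS => dimY big hY hL.
have dimW : (\dim W <= (\dim Y).+1)%N by exact: dim_addv_line.
have [|y0 y0W] := @notin_subv_ex W; first by lia.
have YW : {subset Y <= W} by move=> ?; apply: memv_addl.
have /addv_lineP[c gy0] := hL _ y0W; exists c.
(* The ratio [c] is read off at the single vector [y0]; it remains to see that [g] maps all of V
   into Y. *)
pose g y := h y - c *: y; rewrite -/(g y0) in gy0; rewrite -/(g _).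
have gD y z : g (y + z) = g y + g z.
  by rewrite /g linearD /= scalerDr opprD addrACA.
have gZ a y : g (a *: y) = a *: g y.
  by rewrite /g linearZ /= scalerBr !scalerA mulrC.
have gY y : y \in Y -> g y \in Y by move=> yY; rewrite memvB ?hY ?memvZ.
have gL y : y \notin W -> g y \in (Y + <[y]>)%VS.
  by move=> /hL yL; rewrite memvB ?memvZ ?memv_line_addr.
(* Modulo Y, [g y] equals [g (y + z)], so it lies on the lines of both [y] and [y + z], which meet
   only in 0. *)
have stepA y z : y \notin W -> z \notin W -> y + z \notin W ->
    y \notin (Y + <[z]>)%VS -> g z \in Y -> g y \in Y.
  move=> yW zW yzW yz gz.
  have yzy : y + z \notin (Y + <[y]>)%VS.
    apply/negP => yzy; have zy : z \in (Y + <[y]>)%VS.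
      by rewrite -(addKr y z) addrC memvB ?memv_line_addr.
    by case/negP: zW; apply/YW/(cap_addv_lines yz) => //; apply: memv_line_addr.
  suff gyz : g (y + z) \in Y by rewrite -(addrK (g z) (g y)) -gD memvB.
  apply: (cap_addv_lines yzy); last exact: gL.
  by rewrite gD memvD ?gL // memv_addl.
have stepB y : y \notin W -> g y \in Y.
  move=> yW; have [/addv_lineP[a ya]|yy0] := boolP (y \in (Y + <[y0]>)%VS).
    by rewrite -(subrK (a *: y0) y) gD gZ memvD ?memvZ // gY.
  have [yy0W|] := boolP (y + y0 \in W); last by move=> ?; apply: (stepA y y0).
  (* Here [y + y0] falls in W. Either [y0] is rescaled so that [y + a *: y0] leaves W, or [w]
     outside [W + <[y0]>] serves as a relay from [y0] to [y]. *)
  case: big => [[a [a0 a1]]|dim3].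
    have ay0 b : b != 0 -> b *: y0 \notin W.
      by move=> b0; apply: contraNN y0W => bW; rewrite -(scalerK b0 y0) memvZ.
    apply: (stepA y (a *: y0)); rewrite ?ay0 ?gZ ?memvZ //.
      rewrite -(subrK 1 a) scalerDl scale1r addrCA addrC.
      by rewrite addv_notin // ay0 // subr_eq0.
    apply: contraNN yy0 => /addv_lineP[b]; rewrite scalerA => yb.
    by apply/addv_lineP; exists (b * a).
  have [|w wWy0] := @notin_subv_ex (W + <[y0]>)%VS.
    by have := dim_addv_line W y0; lia.
  have wW : w \notin W by apply: contraNN wWy0; apply: memv_addl.
  have sub : {subset (Y + <[y0]>)%VS <= (W + <[y0]>)%VS}.
    by apply/subvP; rewrite addvS ?addvSl ?subvv.
  have gw : g w \in Y.
    apply: (stepA w y0) => //; last by apply: contraNN wWy0; apply: sub.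
    apply: contraNN wWy0 => wy0; rewrite -(addrK y0 w) memvB ?memv_line_addr //.
    exact: memv_addl.
  have yWy0 : y \in (W + <[y0]>)%VS.
    by rewrite -(addrK y0 y) memvB ?memv_line_addr // memv_addl.
  apply: (stepA y w) => //.
    apply: contraNN wWy0 => yw; rewrite -(addKr y w) addrC memvB //.
    exact: memv_addl.
  apply: contraNN yW => /addv_lineP[b yb]; apply: (cap_addv_lines wWy0) => //.
  by apply/addv_lineP; exists b; apply: YW.
(* A vector of W is a difference of two vectors outside W. *)
move=> y; rewrite -/(g y); have [yW|/stepB//] := boolP (y \in W).
rewrite -(addrK (g y0) (g y)) -gD memvB //.
by apply: stepB; apply: addv_notin.
Qed.

(** Two proper subspaces never cover V. In use, N consists of the [y] such that [elem V i y] is in R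
    + L(Y), so that adding a [y] outside N to Y enlarges R + L(Y). *)
Lemma pick_two Y N d v : (\dim Y + 3 <= \dim {:V})%N -> (Y <= N)%VS ->
    v \notin N -> d \notin Y ->
  exists y1 y2, [/\ y1 \notin (Y + <[d]>)%VS, y2 \notin (Y + <[d]>)%VS,
    y1 \notin N, y2 \notin N & y2 \notin (Y + <[y1]>)%VS].
Proof.
move=> dimY YN vN dY; have [dN|dN] := boolP (d \in N).
  have sub : (Y + <[d]> <= N)%VS by rewrite subv_add YN -memvE.
  have vYd : v \notin (Y + <[d]>)%VS.
    by apply: contraNN vN => /(subvP sub).
  have dvN : d + v \notin N by exact: addv_notin.
  exists v, (d + v); split=> //; first exact: addv_notin (memv_line_addr _ _) _.
  apply: contraNN dY => dv; apply: (cap_addv_lines vYd) (memv_line_addr _ _) _.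
  by rewrite -(addrK v d) memvB ?memv_line_addr.
(* Translation by [d] stays outside W and moves a vector of N out of N. *)
have avoid W : d \in W -> (\dim W < \dim {:V})%N ->
    exists2 y, y \notin W & y \notin N.
  move=> dW /notin_subv_ex[w wW]; have [wN|] := boolP (w \in N); last by exists w.
  by exists (d + w); [apply: addv_notin | rewrite addrC addv_notin].
have dimYd := dim_addv_line Y d.
have [||y1 y1d y1N] := avoid (Y + <[d]>)%VS; [exact: memv_line_addr|lia|].
have [||y2 y2d y2N] := avoid (Y + <[d]> + <[y1]>)%VS.
- exact/memv_addl/memv_line_addr.
- by have := dim_addv_line (Y + <[d]>)%VS y1; lia.
exists y1, y2; split=> //; first by apply: contraNN y2d; apply: memv_addl.
by apply: contraNN y2d; apply/subvP; rewrite addvS ?addvSl ?subvv.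
Qed.

End Lines.

(** * Maps with range in a subspace, and rank-one maps *)

Section HomsInto.

Variables (K : fieldType) (U V : vectType K).
Implicit Types (Y Z : {vspace V}) (s : 'Hom(U, V)).

(* Linear in s, with kernel the maps whose range lies in Y. *)
Definition proj_defect Y s : 'Hom(U, V) := s - (projv Y \o s)%VF.

Fact proj_defect_linear Y : linear (proj_defect Y).
Proof.
move=> a s t; rewrite /proj_defect comp_lfunDr -comp_lfunZr opprD addrACA.
by rewrite scalerBr.
Qed.

HB.instance Definition _ Y :=
  GRing.isLinear.Build K 'Hom(U, V) 'Hom(U, V) _ _ (proj_defect_linear Y).

Definition homs_into Y : {vspace 'Hom(U, V)} := lker (linfun (proj_defect Y)).

Lemma homs_intoP Y s :
  reflect (forall u, s u \in Y) (s \in homs_into Y).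
Proof.
rewrite memv_ker lfunE subr_eq0; apply: (iffP eqP) => [-> u|sY].
  by rewrite comp_lfunE memv_proj.
by apply/lfunP => u; rewrite comp_lfunE projv_id.
Qed.

Lemma homs_intoS Y Z : (Y <= Z)%VS -> (homs_into Y <= homs_into Z)%VS.
Proof.
by move=> /subvP YZ; apply/subvP => s /homs_intoP sY; apply/homs_intoP => u;
  apply: YZ.
Qed.

Local Notation coordU := (coord (vbasis {:U})).

(* The rank-one map e_i^* (x) y, for the dual basis e^* of the basis of U. *)
Definition elem_fun i (y : V) (u : U) : V := coordU i u *: y.

Fact elem_fun_linear i y : linear (elem_fun i y).
Proof. by move=> a u v; rewrite /elem_fun linearP scalerDl scalerA. Qed.

HB.instance Definition _ i y :=
  GRing.isLinear.Build K U V _ _ (elem_fun_linear i y).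

Definition elem_map i (y : V) : 'Hom(U, V) := linfun (elem_fun i y).

Fact elem_map_linear i : linear (elem_map i).
Proof.
move=> a y z; apply/lfunP => u; rewrite add_lfunE scale_lfunE !lfunE /=.
by rewrite /elem_fun scalerDr !scalerA mulrC.
Qed.

HB.instance Definition _ i :=
  GRing.isLinear.Build K V 'Hom(U, V) _ _ (elem_map_linear i).

Definition elem i : 'Hom(V, 'Hom(U, V)) := linfun (elem_map i).

Lemma elemE i y u : elem i y u = coordU i u *: y.
Proof. by rewrite !lfunE. Qed.

Lemma elem_into i y Y : y \in Y -> elem i y \in homs_into Y.
Proof. by move=> yY; apply/homs_intoP => u; rewrite elemE memvZ. Qed.

Lemma hom_sum_elem s : s = \sum_i elem i (s (vbasis {:U})`_i).
Proof.
apply/lfunP => u; rewrite sum_lfunE {1}(coord_vbasis (memvf u)) linear_sum /=.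
by apply: eq_bigr => i _; rewrite linearZ elemE.
Qed.

Lemma elem_notin (M : {vspace 'Hom(U, V)}) :
  M != fullv -> exists i v, elem i v \notin M.
Proof.
move=> MT; apply: NNPP => none; case/eqP: MT; apply/eqP.
rewrite eqEsubv subvf; apply/subvP => s _; rewrite (hom_sum_elem s).
apply: memv_suml => i _; apply: contraT => eM.
by case: none; exists i, (s (vbasis {:U})`_i).
Qed.

(** Rank-one maps at a coordinate where [u] is nonzero send [u] to any prescribed vector up to a
    scalar. Those with values in a complement of Z thus form a space of dimension dim V - dim Z that
    meets M trivially. *)
Lemma dim_eval_into (M : {vspace 'Hom(U, V)}) (u : U) Z : u != 0 ->
    (forall r, r \in M -> r u \in Z) ->
  (\dim M + \dim {:V} <= \dim {:'Hom(U, V)} + \dim Z)%N.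
Proof.
move=> u0 MZ; have [i ui] : exists i, coordU i u != 0.
  apply: NNPP => none; case/eqP: u0; rewrite (coord_vbasis (memvf u)).
  apply: big1 => i _; have [->|ui] := eqVneq (coordU i u) 0; first exact: scale0r.
  by case: none; exists i.
have ZC z : z \in (Z^C)%VS -> elem i z u \in Z -> z = 0.
  rewrite elemE => zC zZ; apply/eqP; rewrite -memv0 -(capv_compl Z) memv_cap zC.
  by rewrite -(scalerK ui z) memvZ.
have dimC : \dim (elem i @: Z^C) = \dim Z^C.
  apply: limg_dim_eq; apply/eqP; rewrite -subv0; apply/subvP => z.
  rewrite memv_cap memv_ker memv0 => /andP[zC /eqP ez].
  by rewrite (ZC z) // ez zero_lfunE mem0v.
have disj : (M :&: elem i @: Z^C = 0)%VS.
  apply/eqP; rewrite -subv0; apply/subvP => r.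
  rewrite memv_cap memv0 => /andP[rM /memv_imgP[z zC er]].
  by rewrite er (ZC z) ?linear0 // -er MZ.
have := dimvS (subvf (M + elem i @: Z^C)%VS).
by rewrite (dimv_disjoint_sum disj) dimC dimv_compl; have := dimvS (subvf Z); lia.
Qed.

End HomsInto.

(** * Locality modulo a subspace, by induction *)

Section LocalModulo.

Variables (K : fieldType) (U V : vectType K) (S : affspace 'Hom(U, V)).
Variables (F : 'Hom(U, V) -> V) (d : V) (k : nat).
Hypotheses (F_affine : affine_on S F)
  (F_qrc : forall s, s \in S -> d \notin limg s -> F s \in limg s)
  (k_ge2 : (2 <= k)%N)
  (k_big : (exists a : K, a != 0 /\ a != 1) \/ (3 <= k)%N).
Implicit Types (Y Z : {vspace V}).

Local Notation R := (aff_dir S).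

Lemma qrc_into Z s : d \notin Z -> s \in S -> s \in homs_into U Z -> F s \in Z.
Proof.
move=> dZ sS /homs_intoP sZ; have sub : (limg s <= Z)%VS.
  by apply/subvP => _ /memv_imgP[u _ ->].
by apply: (subvP sub); apply: F_qrc => //; apply: contraNN dZ => /(subvP sub).
Qed.

Lemma affspace_subr s t : s \in S -> t \in S -> s - t \in R.
Proof.
move=> sS tS; have -> : s - t = (s - aff_pt S) - (t - aff_pt S).
  by rewrite opprB addrA subrK.
exact: memvB.
Qed.

Lemma affspace_addr s r : s \in S -> r \in R -> s + r \in S.
Proof.
by move=> sS rR; rewrite unfold_in /= /in_affspace addrAC memvD.
Qed.

Lemma local_modulo_full Y : d \notin Y -> (\dim Y + k <= \dim {:V})%N ->
    (R + homs_into U Y)%VS = fullv ->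
  exists x, forall s, s \in S -> F s - s x \in Y.
Proof.
move=> dY dimY full; have [f fP] := F_affine.
set L := homs_into U Y in full.
(* Fullness yields a point [s0] of S with range in Y; taken as origin, it makes F linear modulo Y,
   since F s0 is in Y. *)
have /memv_addP[r0 r0R [s0 s0Y es0]] : aff_pt S \in (R + L)%VS.
  by rewrite full memvf.
have s0S : s0 \in S.
  by rewrite unfold_in /= /in_affspace es0 opprD addrCA subrr addr0 memvN.
have FE r : r \in R -> F (s0 + r) = F s0 + f (vsproj R r).
  by move=> rR; rewrite -fP // vsprojK.
have fZ Z r : d \notin Z -> (Y <= Z)%VS -> r \in R -> r \in homs_into U Z ->
    f (vsproj R r) \in Z.
  move=> dZ YZ rR rZ; rewrite -(addKr (F s0) (f _)) -FE // addrC memvB //.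
    apply: qrc_into => //; first exact: affspace_addr.
    by rewrite memvD // (subvP (homs_intoS _ YZ)).
  by apply: (subvP YZ); apply: qrc_into.
(* Extension of [f] from R to all maps, killing the L(Y) component; modulo Y, the chosen
   decomposition is irrelevant by [fZ] with Z = Y. *)
pose g : 'Hom('Hom(U, V), V) := (f \o linfun (vsproj R) \o addv_pi1 R L)%VF.
have gE t : g t = f (vsproj R (addv_pi1 R L t)) by rewrite !comp_lfunE lfunE.
have pi1R t : addv_pi1 R L t \in R by exact: memv_pi1.
have pi12 t : t = addv_pi1 R L t + addv_pi2 R L t.
  by rewrite addv_pi1_pi2 // full memvf.
have gZ Z t : d \notin Z -> (Y <= Z)%VS -> t \in homs_into U Z -> g t \in Z.
  move=> dZ YZ tZ; rewrite gE fZ // -(addrK (addv_pi2 R L t) (addv_pi1 R L t)).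
  by rewrite -pi12 memvB // (subvP (homs_intoS _ YZ)) // memv_pi2.
have fg r : r \in R -> f (vsproj R r) - g r \in Y.
  move=> rR; rewrite gE -!linearB; apply: fZ => //; first exact: memvB.
  by rewrite {1}(pi12 r) addrC addKr memv_pi2.
have [c cP] : exists c : 'I_(\dim {:U}) -> K,
    forall i y, g (elem V i y) - c i *: y \in Y.
  apply: (@fin_all_exists _ (fun=> K)
    (fun i a => forall y, g (elem V i y) - a *: y \in Y)) => i.
  have [|||y|c cP] := @quasi_homothety _ _ (g \o elem V i)%VF Y d; first by lia.
  - by case: k_big => [?|]; [left | right; lia].
  - by move=> y yY; rewrite comp_lfunE gZ // elem_into.
  - move=> yd; rewrite comp_lfunE; apply: gZ; rewrite ?addvSl //.
      apply: contraNN dY => dy; apply: (cap_addv_lines yd) dy.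
      exact: memv_line_addr.
    exact/elem_into/memv_line_addr.
  by exists c => y; rewrite -(comp_lfunE g).
(* The homothety ratios are the coordinates of the sought vector. *)
pose x := \sum_i c i *: (vbasis {:U})`_i.
have gx t : g t - t x \in Y.
  have -> : g t = \sum_i g (elem V i (t (vbasis {:U})`_i)).
    by rewrite {1}(hom_sum_elem t) linear_sum.
  have -> : t x = \sum_i c i *: t (vbasis {:U})`_i.
    by rewrite linear_sum; apply: eq_bigr => i _; rewrite linearZ.
  by rewrite -sumrB; apply: memv_suml => i _; apply: cP.
exists x => s sS; have sR := affspace_subr sS s0S.
have Fs0 : F s0 \in Y by apply: qrc_into.
rewrite -(subrK s0 s) (addrC (s - s0)) FE // add_lfunE opprD addrACA.
apply: memvD; first by rewrite memvB // (homs_intoP _ _ s0Y).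
by rewrite -(subrK (g (s - s0)) (f _)) -addrA memvD ?fg.
Qed.

(** The dimension hypothesis is codim (R + L(Y)) + dim Y + k <= dim V. It survives the addition of a
    line to Y: dim Y grows by at most one, and the codimension drops by at least one. *)
Lemma local_modulo Y : d \notin Y ->
    (\dim {:'Hom(U, V)} + \dim Y + k <=
       \dim {:V} + \dim (R + homs_into U Y))%N ->
  exists x, forall s, s \in S -> F s - s x \in Y.
Proof.
pose M Y := (R + homs_into U Y)%VS.
have [m] := ubnP (\dim {:'Hom(U, V)} - \dim (M Y)).
elim: m Y => // m IHm Y; rewrite ltnS => le_m.
move=> dY dimM; have [full|nfull] := eqVneq (M Y) fullv.
  by apply: local_modulo_full (full) => //; move: dimM; rewrite -/(M Y) full; lia.
have ltM : (\dim (M Y) < \dim {:'Hom(U, V)})%N.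
  by move: nfull; rewrite eqEdim subvf -ltnNge.
have [i [v iv]] := elem_notin nfull.
have [|||y1 [y2 [y1d y2d y1M y2M y12]]] :=
  @pick_two _ _ Y (elem V i @^-1: M Y)%VS d v _ _ _ dY.
- by move: dimM; rewrite -/(M Y); lia.
- by apply/subvP => y yY; rewrite -memv_preim memv_addr // elem_into.
- by rewrite -memv_preim.
have step y : y \notin (Y + <[d]>)%VS -> y \notin (elem V i @^-1: M Y)%VS ->
    (\dim (M Y) < \dim (M (Y + <[y]>)%VS))%N /\
    exists x, forall s, s \in S -> F s - s x \in (Y + <[y]>)%VS.
  move=> yd yM; have ltMy : (\dim (M Y) < \dim (M (Y + <[y]>)%VS))%N.
    have sub : (M Y <= M (Y + <[y]>))%VS.
      by rewrite addvS ?subvv // homs_intoS ?addvSl.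
    rewrite ltn_neqAle dimvS // andbT (dimv_leqif_sup sub).
    apply: contraNN yM => /subvP sub'; rewrite -memv_preim sub' //.
    exact/memv_addr/elem_into/memv_line_addr.
  split=> //; apply: IHm.
  - by lia.
  - apply: contraNN dY => dy; apply: (cap_addv_lines yd) dy.
    exact: memv_line_addr.
  - by move: dimM (dim_addv_line Y y); rewrite -!/(M _); lia.
have [ltM1 [x1 x1P]] := step y1 y1d y1M; have [_ [x2 x2P]] := step y2 y2d y2M.
suff ex : x1 = x2.
  exists x1 => s sS; apply: (cap_addv_lines y12); first exact: x1P.
  by rewrite ex x2P.
apply/eqP; rewrite -subr_eq0; apply: contraT => x0.
pose Z := (Y + <[y1]> + <[y2]>)%VS.
have Y1Z : (Y + <[y1]> <= Z)%VS by apply: addvSl.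
have Y2Z : (Y + <[y2]> <= Z)%VS by rewrite addvS ?addvSl ?subvv.
have sZ s : s \in S -> s (x1 - x2) \in Z.
  move=> sS; have -> : s (x1 - x2) = (F s - s x2) - (F s - s x1).
    by rewrite linearB opprB [RHS]addrC subrKA.
  rewrite memvB //; first exact: subvP Y2Z _ (x2P _ sS).
  exact: subvP Y1Z _ (x1P _ sS).
(* Elements of R are differences of points of S, and maps in L(Y1) have range in Z already. *)
have evZ r : r \in M (Y + <[y1]>)%VS -> r (x1 - x2) \in Z.
  case/memv_addP=> r1 r1R [l /homs_intoP lY ->]; rewrite add_lfunE memvD //.
    have ptS : aff_pt S \in S by rewrite unfold_in /= /in_affspace subrr mem0v.
    rewrite -(addKr (aff_pt S) r1) add_lfunE opp_lfunE addrC memvB ?sZ //.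
    exact: affspace_addr.
  exact: subvP Y1Z _ (lY _).
(* As dim Z <= dim Y + 2 <= dim Y + k, evaluation at [x1 - x2] bounds dim (R + L(Y1)) by dim (R +
   L(Y)), against [ltM1]. *)
have := dim_addv_line Y y1; have := dim_addv_line (Y + <[y1]>)%VS y2.
have := dim_eval_into x0 evZ.
by move: dimM ltM1; rewrite -/(M Y) -/Z; lia.
Qed.

End LocalModulo.

Theorem theorem5p1 (K : fieldType) (U V : vectType K)
    (S : affspace 'Hom(U, V))
    (codim_gt2 : card_gt K 2 -> (aff_codim S + 2 <= \dim {:V})%N)
    (codim_eq2 : card_eq K 2 -> (aff_codim S + 3 <= \dim {:V})%N)
    (F : 'Hom(U, V) -> V)
    (F_affine : affine_on S F)
    (F_qrc : quasi_range_compatible (mem S) F) :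
  local_on (mem S) F.
Proof.
have [D [dimD qrc]] := F_qrc.
have d0 : vpick D != 0 by rewrite vpick0 -dimv_eq0 dimD.
have eD : D = <[vpick D]>%VS.
  by apply/esym/eqP; rewrite eqEdim -memvE memv_pick dimD dim_vline d0.
have qrc' s : s \in S -> vpick D \notin limg s -> F s \in limg s.
  by move=> sS dN; apply: qrc => //; rewrite eD -memvE.
(* A scalar [a] other than 0 and 1 gives three elements of K and k = 2; otherwise K = {0, 1} and k =
   3. *)
have [k [k2 kbig dimk]] : exists k, [/\ (2 <= k)%N,
    (exists a : K, a != 0 /\ a != 1) \/ (3 <= k)%N &
    (aff_codim S + k <= \dim {:V})%N].
  have [[a [a0 a1]]|none] := classic (exists a : K, a != 0 /\ a != 1).
    exists 2; split=> //; first by left; exists a.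
    apply: codim_gt2; exists (fun i : 'I_3 => [:: 0; 1; a]`_i) => i j /eqP.
    rewrite nth_uniq ?ltn_ord // => [/eqP/val_inj//|].
    by rewrite /= !inE negb_or eq_sym oner_eq0 !(eq_sym _ a) a0 a1.
  exists 3; split=> //; first by right.
  apply: codim_eq2; exists (fun i : 'I_2 => [:: 0; 1]`_i).
  exists (fun a : K => if a == 0 then ord0 else ord_max).
    by case=> [[|[|//]] lti] /=; apply: val_inj; rewrite /= ?eqxx ?oner_eq0.
  move=> a; have [->//|a0] := eqVneq a 0; have [->//|a1] := eqVneq a 1.
  by case: none; exists a.
have [||x xP] := local_modulo (Y := 0%VS) F_affine qrc' k2 kbig.
- by rewrite memv0.
- have := dimvS (addvSl (aff_dir S) (homs_into U (0 : {vspace V}))).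
  have := dimvS (subvf (aff_dir S)); move: dimk.
  by rewrite dimv0 addn0 /aff_codim; lia.
by exists x => s sS; apply/eqP; rewrite -subr_eq0 -memv0 xP.
Qed.
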